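(* Consider the smart-metering model described in the context, with a finite horizon $T$. Define $V_{T+1}\equiv 0$ on $\mathcal P_{X,S}$ and, for $t=T,T-1,\dots,1$, $$V_t(\pi)=\min_{a\in\mathcal A}\,[\mathscr B_a V_{t+1}](\pi),\qquad \pi\in\mathcal P_{X,S}.$$ Then: (1) each $V_t$ is continuous and concave on $\mathcal P_{X,S}$ (and the minimum is attained); (2) if $f_t^*(\pi)$ denotes a minimizer of the right-hand side, then the policy $\mathbf q^*$ given by $q^*_t(y\mid x^t,s^t,y^{t-1})=a_t(y\mid x_t,s_t)$ with $a_t=f^*_t(\pi_t)$, where $\pi_t$ is the belief state (computed by $\pi_1(x,s)=P_{X_1}(x)P_{S_1}(s)$ and $\pi_{t+1}=\varphi(\pi_t,y_t,a_t)$), is optimal, i.e. it minimizes $L_T$ over $\mathcal Q_A$; in particular there is no loss of optimality in restricting attention to policies of the form $q_t(y_t\mid x_t,s_t,\pi_t)$; (3) the optimal finite-horizon leakage rate $\min_{\mathbf q\in\mathcal Q_A}L_T(\mathbf q)$ equals $V_1(\pi_1)/T$ where $\pi_1(x,s)=P_{X_1}(x)P_{S_1}(s)$.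
   Context: Let $\mathcal X=\{0,\dots,m_x\}$, $\mathcal Y=\{0,\dots,m_y\}$, $\mathcal S=\{0,\dots,m_s\}$ with $m_x\le m_y$. The demand $\{X_t\}_{t\ge1}$ is a time-homogeneous first-order Markov chain on $\mathcal X$ with irreducible aperiodic transition matrix $Q(x'\mid x)$ and initial pmf $P_{X_1}$; the initial battery charge $S_1\in\mathcal S$ has pmf $P_{S_1}$ and is independent of $\{X_t\}$. For an integer $w$ let $\mathcal Y_\circ(w)=\{y\in\mathcal Y: w+y\in\mathcal S\}$. A charging policy $\mathbf q=(q_1,q_2,\dots)$ is a sequence of conditional pmfs $q_t(y\mid x^t,s^t,y^{t-1})$ on $\mathcal Y$ satisfying $\sum_{y\in\mathcal Y_\circ(s_t-x_t)}q_t(y\mid x^t,s^t,y^{t-1})=1$; $\mathcal Q_A$ denotes the set of all such policies. A policy induces the joint law $P^{\mathbf q}(s^T,x^T,y^T)=P_{S_1}(s_1)P_{X_1}(x_1)q_1(y_1|x_1,s_1)\prod_{t=2}^T\mathbf 1\{s_t=s_{t-1}-x_{t-1}+y_{t-1}\}Q(x_t|x_{t-1})q_t(y_t|x^t,s^t,y^{t-1})$ (so $S_{t+1}=S_t+Y_t-X_t$). The leakage rate is $L_T(\mathbf q)=\frac1T I^{\mathbf q}(X^T,S_1;Y^T)$. $\mathcal P_{X,S}$ is the set of pmfs on $\mathcal X\times\mathcal S$ and $\mathcal A$ is the set of conditional pmfs $a(y\mid x,s)$ from $\mathcal X\times\mathcal S$ to $\mathcal Y$ with $a(\mathcal Y_\circ(s-x)\mid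 x,s)=1$ for all $(x,s)$. For $a\in\mathcal A$, $\pi\in\mathcal P_{X,S}$, $I(a;\pi)$ is the mutual information between $(X,S)\sim\pi$ and $Y$ with $P(Y=y\mid X=x,S=s)=a(y\mid x,s)$. The filter is $$\varphi(\pi,y,a)(x',s')=\frac{\sum_{x\in\mathcal X}Q(x'\mid x)\,a(y\mid x,s'+x-y)\,\pi(x,s'+x-y)}{\sum_{(x,s)\in\mathcal X\times\mathcal S}a(y\mid x,s)\pi(x,s)}$$ (terms with $s'+x-y\notin\mathcal S$ are zero; if the denominator is zero, $\varphi$ is an arbitrary pmf). For $V:\mathcal P_{X,S}\to\mathbb R$, the Bellman operator is $[\mathscr B_aV](\pi)=I(a;\pi)+\sum_{x,s,y}\pi(x,s)a(y\mid x,s)V(\varphi(\pi,y,a))$. The belief state under a policy is $\pi_t(x,s)=P^{\mathbf q}(X_t=x,S_t=s\mid Y^{t-1}=y^{t-1})$. *)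

(* Defs.v *)
From HB Require Import structures.
From mathcomp Require Import all_boot all_order all_algebra.
From mathcomp Require Import all_classical all_reals all_analysis.
Set Implicit Arguments.
Unset Strict Implicit.
Unset Printing Implicit Defensive.
Import Order.TTheory GRing.Theory Num.Theory.
Import numFieldNormedType.Exports.
Local Open Scope ring_scope.
Local Open Scope classical_set_scope.

Section Model.
Variable R : realType.

Definition is_pmf (T : finType) (p : T -> R) : Prop :=
  (forall t, 0 <= p t) /\ \sum_t p t = 1.

Definition mutinf (A B : finType) (p : A -> B -> R) : R :=
  \sum_(a : A) \sum_(b : B)
    (if p a b == 0 then 0
     else p a b * ln (p a b / ((\sum_(b' : B) p a b') * (\sum_(a' : A) p a' b)))).

Definition tat (n m : nat) (f : {ffun 'I_n -> 'I_m.+1}) (i : nat) : 'I_m.+1 :=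
  match (insub i : option 'I_n) with Some j => f j | None => ord0 end.

Definition pre (n m : nat) (f : {ffun 'I_n -> 'I_m.+1}) (k : nat)
  : {ffun 'I_k -> 'I_m.+1} := [ffun i : 'I_k => tat f i].

(* Markov transition matrix: Q x x' = Q(x' | x) *)
Definition stochastic (n : nat) (Q : 'M[R]_n) : Prop :=
  (forall i j, 0 <= Q i j) /\ (forall i, \sum_j Q i j = 1).
Definition irreducible (n : nat) (Q : 'M[R]_n.+1) : Prop :=
  forall i j, exists k : nat, 0 < (Q ^+ k) i j.
(* the gcd of the return times {k >= 1 : Q^k(i|i) > 0} of every state is 1 *)
Definition aperiodic (n : nat) (Q : 'M[R]_n.+1) : Prop :=
  forall i (d : nat), (forall k : nat, (0 < k)%N -> 0 < (Q ^+ k) i i -> (d %| k)%N) -> d = 1%N.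

Variables mx my ms : nat.
Local Notation X := 'I_mx.+1.
Local Notation Y := 'I_my.+1.
Local Notation S := 'I_ms.+1.
Local Notation M := 'M[R]_(mx.+1, ms.+1).

(* y \in Y_o(s - x)  <=>  s - x + y \in S *)
Definition inYo (s : S) (x : X) (y : Y) : bool :=
  ((0 <= Posz s - Posz x + Posz y) && (Posz s - Posz x + Posz y <= Posz ms))%R.

(* the set of admissible conditional pmfs a(y | x, s), written a x s y *)
Definition Aset : set (X -> S -> Y -> R) :=
  [set a | forall x s, is_pmf (a x s) /\ \sum_(y | inYo s x y) a x s y = 1].

Definition simplex : set M :=
  [set p | (forall x s, 0 <= p x s) /\ \sum_x \sum_s p x s = 1].

Definition concave_on (D : set M) (f : M -> R) : Prop :=
  forall p1 p2 (l : R), D p1 -> D p2 -> 0 <= l <= 1 ->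
    l * f p1 + (1 - l) * f p2 <= f (l *: p1 + (1 - l) *: p2).

Variable Q : 'M[R]_(mx.+1).
(* the arbitrary pmf used by the filter when the normaliser vanishes *)
Variable phi0 : M -> Y -> (X -> S -> Y -> R) -> M.

Definition Iap (a : X -> S -> Y -> R) (pi : M) : R :=
  mutinf (fun (xs : X * S) (y : Y) => pi xs.1 xs.2 * a xs.1 xs.2 y).

Definition shift (s' : S) (x : X) (y : Y) : option S :=
  if (y <= s' + x)%N then (insub (s' + x - y)%N : option S) else None.

Definition filt (pi : M) (y : Y) (a : X -> S -> Y -> R) : M :=
  let D := \sum_x \sum_s a x s y * pi x s in
  if D == 0 then phi0 pi y a
  else \matrix_(x', s')
         ((\sum_x Q x x' *
             (if shift s' x y is Some s then a x s y * pi x s else 0)) / D).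

Definition bell (a : X -> S -> Y -> R) (V : M -> R) (pi : M) : R :=
  Iap a pi + \sum_x \sum_s \sum_y pi x s * a x s y * V (filt pi y a).

Fixpoint Vrem (k : nat) : M -> R :=
  match k with
  | 0 => fun _ => 0
  | k'.+1 => fun pi => inf [set bell a (Vrem k') pi | a in Aset]
  end.

(* V_t for horizon T (t is 1-based): V_{T+1} = 0, V_t = min_a B_a V_{t+1} *)
Definition Vt (T t : nat) : M -> R := Vrem (T.+1 - t).

(* policies q_t(y | x^t, s^t, y^{t-1}); time index t is 0-based here, so the
   histories have lengths t+1, t+1, t *)
Definition policy : Type :=
  forall t : nat, {ffun 'I_t.+1 -> X} -> {ffun 'I_t.+1 -> S} ->
                  {ffun 'I_t -> Y} -> Y -> R.

Definition QA : set policy :=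
  [set q : policy | forall (t : nat) (xs : {ffun 'I_t.+1 -> X})
      (ss : {ffun 'I_t.+1 -> S}) (ys : {ffun 'I_t -> Y}), is_pmf (q t xs ss ys) /\
      \sum_(y | inYo (ss ord_max) (xs ord_max) y) q t xs ss ys y = 1].

Variables (PX1 : X -> R) (PS1 : S -> R).

Definition law (T : nat) (q : policy) (ss : {ffun 'I_T -> S})
    (xs : {ffun 'I_T -> X}) (ys : {ffun 'I_T -> Y}) : R :=
  PS1 (tat ss 0) * PX1 (tat xs 0) *
  (\prod_(t < T) q t (pre xs t.+1) (pre ss t.+1) (pre ys t) (ys t)) *
  \prod_(1 <= t < T)
     ((Posz (tat ss t) == Posz (tat ss t.-1) - Posz (tat xs t.-1) + Posz (tat ys t.-1))%:R
      * Q (tat xs t.-1) (tat xs t)).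

(* L_T(q) = I(X^T, S_1; Y^T) / T *)
Definition leak (T : nat) (q : policy) : R :=
  mutinf (fun (xs1 : {ffun 'I_T -> X} * S) (ys : {ffun 'I_T -> Y}) =>
            \sum_(ss : {ffun 'I_T -> S} | tat ss 0 == xs1.2) law q ss xs1.1 ys)
  / T%:R.

Definition pi1 : M := \matrix_(x, s) (PX1 x * PS1 s).

(* belief states under the selector f (f t = f*_t, t 1-based):
   bel 0 = pi_1, bel (k+1) = phi(bel k, y_k, f_(k+1)(bel k)) *)
Fixpoint bel (f : nat -> M -> (X -> S -> Y -> R)) (ysq : nat -> Y) (k : nat) : M :=
  match k with
  | 0 => pi1
  | k'.+1 => filt (bel f ysq k') (ysq k') (f k' .+1 (bel f ysq k'))
  end.

Definition qstar (f : nat -> M -> (X -> S -> Y -> R)) : policy :=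
  fun t xs ss ys y => f t.+1 (bel f (tat ys) t) (xs ord_max) (ss ord_max) y.

End Model.

Arguments simplex {R mx ms}.
Arguments Aset {R mx my ms}.
Arguments QA {R mx my ms}.
Arguments is_pmf {R T}.
Arguments concave_on {R mx ms}.

(* Main.v *)
(** With [h u = u ln u], which is continuous on all of R, and for an admissible
    action, the one-stage information is [sum pi h(a) - sum_y h(P(y))].  The
    terms [h(P(y))] telescope along the horizon when beliefs are left
    unnormalised: the value function [U_k mu = |mu| V(mu / |mu|) - h |mu|] obeys
      [U_0 = - h |mu|],
      [U_(k+1) mu = min_a (sum mu h(a) + sum_y U_k(Phi_y(mu, a)))],
    where [Phi_y] is the filter without its denominator, bilinear in [(mu, a)].
    Continuity follows from compactness of the action set, concavity from that
    of [- h], and scaling [mu] does not change the minimisers.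

    For an arbitrary policy the charges are determined by the demands, the
    outputs and the initial charge, so [T L_T] is
    [sum_t E h(q_t) - sum_y^T h(P(y^T))].  Replacing [q_t] by its
    conditional expectation given the current demand, the current charge and
    the past outputs does not change the law of these variables, and lowers the
    cost by Jensen's inequality for [h]; so [T L_T >= U_T pi_1].  For the policy
    built from minimisers every inequality is an equality. *)
Require Import Defs.
From HB Require Import structures.
From mathcomp Require Import all_boot all_order all_algebra.
From mathcomp Require Import all_classical all_reals all_analysis.
From mathcomp Require Import ring lra zify.
Import Order.TTheory GRing.Theory Num.Theory.
Import numFieldNormedType.Exports.
Set Implicit Arguments.
Unset Strict Implicit.
Unset Printing Implicit Defensive.
Local Open Scope ring_scope.
Local Open Scope classical_set_scope.

(** * The function u ln u: convexity and continuity *)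

Section xlnx.
Variable R : realType.
Implicit Types u v : R.

Definition xlnx u := u * ln u.

Lemma xlnx0 : xlnx 0 = 0. Proof. by rewrite /xlnx mul0r. Qed.

Lemma xlnx1 : xlnx 1 = 0. Proof. by rewrite /xlnx ln1 mulr0. Qed.

Lemma xlnxM u v : 0 <= u -> 0 <= v -> xlnx (u * v) = u * xlnx v + v * xlnx u.
Proof.
rewrite le_eqVlt => /predU1P[<-|u0]; first by rewrite !mul0r xlnx0 mulr0 addr0.
rewrite le_eqVlt => /predU1P[<-|v0]; first by rewrite !mulr0 xlnx0 mulr0 mul0r addr0.
by rewrite /xlnx lnM ?posrE//; ring.
Qed.

(** Convexity in tangent form: multiply [ln (v / u) <= v / u - 1] by [u]. At [u = 0] the claim
    reduces to [- v <= 0]. *)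
Lemma xlnx_tangent u v : 0 <= u -> 0 < v ->
  xlnx v + (1 + ln v) * (u - v) <= xlnx u.
Proof.
rewrite le_eqVlt => /predU1P[<-|u0] v0.
  by rewrite xlnx0 /xlnx; have := v0; nra.
have vu : 0 < v / u by rewrite divr_gt0.
have : ln (1 + (v / u - 1)) <= v / u - 1 by apply: le_ln1Dx; lra.
rewrite addrC subrK ln_div ?posrE// => /(ler_wpM2l (ltW u0)).
have -> : u * (v / u - 1) = v - u by field; rewrite gt_eqF.
by rewrite /xlnx; lra.
Qed.

(** Sum the tangent inequalities at the mean [a]. The weights are not normalised and the mean is
    given by a product, so a zero total weight is allowed; [a = 0] forces every [w i * q i] to
    vanish. *)
Lemma xlnx_jensen (I : finType) (P : pred I) (w q : I -> R) (a : R) :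
  (forall i, P i -> 0 <= w i) -> (forall i, P i -> 0 <= q i) -> 0 <= a ->
  \sum_(i | P i) w i * q i = (\sum_(i | P i) w i) * a ->
  (\sum_(i | P i) w i) * xlnx a <= \sum_(i | P i) w i * xlnx (q i).
Proof.
move=> w0 q0; rewrite le_eqVlt => /predU1P[<-|a0] wq.
  rewrite xlnx0 mulr0 big1 // => i Pi; rewrite /xlnx mulrA.
  move: wq; rewrite mulr0 => /eqP; rewrite psumr_eq0 => [/allP/(_ i)|j Pj].
    by rewrite mem_index_enum Pi => /(_ isT)/eqP ->; rewrite mul0r.
  by rewrite mulr_ge0 ?w0 ?q0.
have -> : (\sum_(i | P i) w i) * xlnx a
    = \sum_(i | P i) w i * (xlnx a + (1 + ln a) * (q i - a)).
  under [RHS]eq_bigr => i _.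
    rewrite (_ : _ * _ = w i * (xlnx a - (1 + ln a) * a) +
      (w i * q i) * (1 + ln a)); last by ring.
    over.
  by rewrite big_split -!mulr_suml wq /=; ring.
by apply: ler_sum => i Pi; rewrite ler_wpM2l ?w0// xlnx_tangent ?q0.
Qed.

Lemma xlnx_convex u v l : 0 <= u -> 0 <= v -> 0 <= l <= 1 ->
  xlnx (l * u + (1 - l) * v) <= l * xlnx u + (1 - l) * xlnx v.
Proof.
move=> u0 v0 /andP[l0 l1].
have := @xlnx_jensen bool xpredT (fun b => if b then l else 1 - l)
  (fun b => if b then u else v) (l * u + (1 - l) * v).
rewrite !big_bool /= (_ : l + (1 - l) = 1) ?mul1r; [apply|by ring].
- by case=> // _; lra.
- by case.
- by apply: addr_ge0; apply: mulr_ge0 => //; lra.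
- by [].
Qed.

(** Gives continuity at 0. With [r] the root of [u], [u ln u = 2 r (r ln r)], and [ln r^-1 <= r^-1]
    bounds [r ln r] by 1 in absolute value. For [u <= 0] the convention [ln u = 0] applies. *)
Lemma xlnx_sqrt_bound u : `|u| <= 1 -> `|xlnx u| <= 2 * Num.sqrt `|u|.
Proof.
move=> u1; have [u0|u0] := leP u 0.
  by rewrite /xlnx ln0// mulr0 normr0 mulr_ge0// sqrtr_ge0.
have {}u1 : u <= 1 by rewrite -(gtr0_norm u0).
rewrite (gtr0_norm u0); set r := Num.sqrt u.
have r0 : 0 < r by rewrite sqrtr_gt0.
have -> : u = r ^+ 2 by rewrite sqr_sqrtr// ltW.
have r1 : r <= 1 by rewrite -sqrtr1 ler_wsqrtr.
have : ln r^-1 <= r^-1 by rewrite ltW// ln_sublinear// invr_gt0.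
rewrite lnV ?posrE// => /(ler_wpM2l (ltW r0)); rewrite mulfV ?gt_eqF// => lnr.
have lr0 : ln r <= 0 by rewrite ln_le0.
rewrite /xlnx lnXn// ler0_norm; last by rewrite mulr_ge0_le0// ?sqr_ge0//; lra.
by rewrite mulr2n; nra.
Qed.

Lemma xlnx_continuous : continuous xlnx.
Proof.
move=> u; case: (ltrgtP u 0) => [u0|u0|->].
- apply: (near_cst_continuous 0); near do rewrite /xlnx ln0 ?mulr0//.
  by near=> v; rewrite ltW//; near: v; exact: lt_nbhsl.
- by apply: cvgM; [exact: cvg_id|exact: continuous_ln].
- rewrite /continuous_at xlnx0; apply/norm_cvg0P.
  apply: (@squeeze_cvgr _ _ _ _ (fun=> 0) (fun v => 2 * Num.sqrt `|v|)).
  + near=> v; rewrite normr_ge0 /=; apply: xlnx_sqrt_bound.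
    by rewrite ltW//; near: v; exact: nbhs0_lt.
  + exact: cvg_cst.
  + rewrite [X in _ --> X](_ : 0 = 2 * Num.sqrt `|0 : R|); last first.
      by rewrite normr0 sqrtr0 mulr0.
    apply: cvgM; first exact: cvg_cst.
    apply: (continuous_comp (@norm_continuous _ R 0)).
    exact: sqrt_continuous.
Unshelve. all: by end_near. Qed.

End xlnx.

(** The identity I(A;B) = H(A) + H(B) - H(A,B). Where [p a b] is positive both marginals are
    positive and the logarithm splits; elsewhere the terms vanish on both sides. *)
Lemma mutinf_xlnx (R : realType) (A B : finType) (p : A -> B -> R) :
  (forall a b, 0 <= p a b) ->
  mutinf p = \sum_a \sum_b xlnx (p a b) - \sum_a xlnx (\sum_b p a b)
             - \sum_b xlnx (\sum_a p a b).
Proof.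
move=> p0; rewrite /mutinf.
have -> : \sum_b xlnx (\sum_a p a b)
    = \sum_a \sum_b p a b * ln (\sum_a' p a' b).
  by rewrite exchange_big; apply: eq_bigr => b _; rewrite /xlnx mulr_suml.
rewrite -!sumrB; apply: eq_bigr => a _.
rewrite /xlnx mulr_suml -!sumrB; apply: eq_bigr => b _.
case: eqP => [->|/eqP pab]; first by rewrite !mul0r !subr0.
have pab0 : 0 < p a b by rewrite lt_def pab p0.
have pa0 : 0 < \sum_b' p a b'.
  by apply: (lt_le_trans pab0); rewrite (bigD1 b)//= lerDl sumr_ge0.
have pb0 : 0 < \sum_a' p a' b.
  by apply: (lt_le_trans pab0); rewrite (bigD1 a)//= lerDl sumr_ge0.
by rewrite ln_div ?posrE ?mulr_gt0// lnM ?posrE//; ring.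
Qed.

(** * Minimisation of a jointly continuous function over a compact set *)

Section inf_compact.
Variables (R : realType) (T U : topologicalType) (K : set T) (F : T * U -> R).
Hypotheses (K0 : K !=set0) (cK : compact K) (cF : continuous F).

Lemma inf_compact_attained u :
  (exists2 v, K v & F (v, u) = inf [set F (v, u) | v in K]) /\
  (forall v, K v -> inf [set F (v, u) | v in K] <= F (v, u)).
Proof.
have cFu : continuous (fun v => F (v, u)).
  move=> v; apply: (continuous_comp (f := fun v => (v, u))); last exact: cF.
  by apply: cvg_pair; [exact: cvg_id|exact: cvg_cst].
have [c] := compact_EVT_min K0 cK (continuous_subspaceT cFu).
rewrite inE => Kc Fc.
have lb : lbound [set F (v, u) | v in K] (F (c, u)).
  by move=> _ [v Kv <-]; rewrite Fc ?inE.
have le v : K v -> inf [set F (v, u) | v in K] <= F (v, u).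
  move=> Kv; apply: ge_inf; first by exists (F (c, u)).
  by exists v.
split => //; exists c => //; apply/eqP; rewrite eq_le le// andbT.
by apply: lb_le_inf => //; exists (F (c, u)), c.
Qed.

(** By compactness one neighbourhood of [u] makes [F (v, u)] and [F (v, u')] close for all [v] in
    [K] at once. Testing the minimiser at each of [u], [u'] against the other point then bounds the
    gap of the infima. *)
Lemma inf_compact_continuous :
  continuous (fun u => inf [set F (v, u) | v in K]).
Proof.
move=> u; apply/cvgrPdist_le => e e0.
have /compact_near_coveringP/(_ U (nbhs u)
    (fun u' v => `|F (v, u) - F (v, u')| < e)) := cK.
have near_e v : K v -> \forall v' \near v & u' \near u,
    `|F (v', u) - F (v', u')| < e.
  move=> Kv; have e2 : 0 < e / 2 by rewrite divr_gt0.
  have /cvgrPdist_lt/(_ _ e2) /= := @cF (v, u).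
  move=> [[A B] /= [nA nB] AB].
  exists (A, B) => // -[v' u'] /= [Av Bu].
  have /= h1 := AB (v', u') (conj Av Bu).
  have /= h2 := AB (v', u) (conj Av (nbhs_singleton nB)).
  rewrite -[X in X - _](subrK (F (v, u))) -addrA (le_lt_trans (ler_normD _ _))//.
  by rewrite distrC [e]splitr ltrD.
move/(_ _ near_e); apply: filterS => u' Fu'.
have [[v Kv vE] lev] := inf_compact_attained u.
have [[v' Kv' vE'] lev'] := inf_compact_attained u'.
have := Fu' _ Kv; have := Fu' _ Kv'; have := lev' _ Kv; have := lev _ Kv'.
rewrite -vE -vE' !ltr_norml ler_norml => h1 h2 /andP[h3 h4] /andP[h5 h6].
by apply/andP; split; lra.
Qed.

End inf_compact.

Lemma continuous_sum (R : realType) (T : topologicalType) (I : finType)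
    (P : pred I) (F : I -> T -> R) :
  (forall i, P i -> continuous (F i)) ->
  continuous (fun t => \sum_(i | P i) F i t).
Proof.
by move=> cF; apply: continuous_big => //; exact: add_continuous.
Qed.

Lemma continuous_matrix (R : realType) (T : topologicalType) (m n : nat)
    (F : T -> 'M[R]_(m, n)) :
  (forall i j, continuous (fun t => F t i j)) -> continuous F.
Proof.
move=> cF t A [P nP PA]; rewrite nbhs_filterE.
have : \forall t' \near t, forall ij : 'I_m * 'I_n, P ij.1 ij.2 (F t' ij.1 ij.2).
  apply: filter_forall => -[i j] /=; exact: (cF i j t).
by apply: filterS => t' Pt; apply: PA => i j; exact: (Pt (i, j)).
Qed.

Lemma is_pmf_out (R : realType) (T : finType) (p : T -> R) (P : pred T) t :
  is_pmf p -> \sum_(t | P t) p t = 1 -> ~~ P t -> p t = 0.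
Proof.
move=> [p0 p1] pP Pt; move: p1; rewrite (bigID P)/= pP => /eqP.
rewrite -subr_eq0 addrAC subrr add0r psumr_eq0// => /allP/(_ t).
by rewrite mem_index_enum Pt => /(_ isT)/eqP.
Qed.

Lemma is_pmf_le1 (R : realType) (T : finType) (p : T -> R) t :
  is_pmf p -> p t <= 1.
Proof. by move=> [p0 <-]; rewrite (bigD1 t)//= lerDl sumr_ge0. Qed.

(** * The value function on unnormalised beliefs *)

Section value.
Variables (R : realType) (mx my ms : nat) (Q : 'M[R]_mx.+1).
Local Notation X := 'I_mx.+1.
Local Notation Y := 'I_my.+1.
Local Notation S := 'I_ms.+1.
Local Notation M := 'M[R]_(mx.+1, ms.+1).
Implicit Types (x : X) (y : Y) (s : S) (mu : M) (a : X -> S -> Y -> R).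

(** Stated over the integers, since subtraction of naturals would truncate. *)
Definition nxt s x y (s' : S) : bool := Posz s' == Posz s - Posz x + Posz y.

Lemma sum_nxt s x y : \sum_s' (nxt s x y s')%:R = (inYo s x y)%:R :> R.
Proof.
have [/andP[h0 h1]|h] := boolP (inYo s x y).
  have lt : (absz (Posz s - Posz x + Posz y)%R < ms.+1)%N by lia.
  rewrite (bigD1 (Ordinal lt))//= big1 => [|s' ns'].
    by rewrite /nxt/= gez0_abs// eqxx addr0.
  rewrite /nxt; case: eqP => // e; case/eqP: ns'; apply/val_inj => /=.
  by rewrite -e absz_nat.
rewrite big1 // => s' _; rewrite /nxt; case: eqP => // e; move/negP: h; case.
by have := ltn_ord s'; rewrite /inYo -e; lia.
Qed.

Hypothesis mxy : (mx <= my)%N.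
Hypothesis stQ : stochastic Q.

Lemma Aset_ge0 a x s y : Aset a -> 0 <= a x s y.
Proof. by move=> /(_ x s)[[]]. Qed.

Lemma Aset_sum1 a x s : Aset a -> \sum_y a x s y = 1.
Proof. by move=> /(_ x s)[[]]. Qed.

Lemma Aset_out a x s y : Aset a -> ~~ inYo s x y -> a x s y = 0.
Proof. by move=> /(_ x s)[pa a1]; apply: is_pmf_out. Qed.

(* Meeting the demand exactly keeps the charge constant, hence is always
   admissible. *)
Definition direct x s y : R := (y == widen_ord (mxy : (mx.+1 <= my.+1)%N) x)%:R.

Lemma Aset_direct : Aset direct.
Proof.
move=> x s; pose y0 := widen_ord (mxy : (mx.+1 <= my.+1)%N) x; split; first split => [y|].
- by rewrite /direct ler0n.
- by rewrite (bigD1 y0)//= /direct eqxx big1 ?addr0// => y /negbTE ->.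
- rewrite (bigD1 y0)/=; last first.
    by rewrite /inYo /= subrK; apply/andP; split => //; rewrite lez_nat -ltnS.
  by rewrite /direct eqxx big1 ?addr0// => y /andP[_ /negbTE ->].
Qed.

Definition mass mu : R := \sum_x \sum_s mu x s.

Definition cone : set M := [set mu | forall x s, 0 <= mu x s].

Lemma mass_ge0 mu : cone mu -> 0 <= mass mu.
Proof. by move=> c; do 2! [apply: sumr_ge0 => ? _]; apply: c. Qed.

Lemma mass_eq0 mu : cone mu -> mass mu = 0 -> mu = 0.
Proof.
move=> c /eqP; rewrite psumr_eq0 => [/allP m0|x _]; last exact: sumr_ge0.
apply/matrixP => x s; rewrite mxE; have := m0 x.
rewrite mem_index_enum => /(_ isT)/=; rewrite psumr_eq0// => /allP/(_ s).
by rewrite mem_index_enum => /(_ isT)/eqP.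
Qed.

Lemma massZ c mu : mass (c *: mu) = c * mass mu.
Proof.
rewrite mulr_sumr; apply: eq_bigr => x _; rewrite mulr_sumr.
by apply: eq_bigr => s _; rewrite mxE.
Qed.

Lemma massD mu nu : mass (mu + nu) = mass mu + mass nu.
Proof.
rewrite -big_split; apply: eq_bigr => x _; rewrite -big_split.
by apply: eq_bigr => s _; rewrite mxE.
Qed.

(* Unnormalised filter: it is bilinear in [mu] and [a] and, unlike [filt],
   needs no convention for outputs of probability zero. *)
Definition ufilt mu y a : M := \matrix_(x', s')
  \sum_x \sum_s mu x s * a x s y * ((nxt s x y s')%:R * Q x x').

Lemma ufiltZ c mu y a : ufilt (c *: mu) y a = c *: ufilt mu y a.
Proof.
apply/matrixP => x' s'; rewrite !mxE mulr_sumr; apply: eq_bigr => x _.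
by rewrite mulr_sumr; apply: eq_bigr => s _; rewrite mxE !mulrA.
Qed.

Lemma ufiltD mu nu y a : ufilt (mu + nu) y a = ufilt mu y a + ufilt nu y a.
Proof.
apply/matrixP => x' s'; rewrite !mxE -big_split; apply: eq_bigr => x _.
by rewrite -big_split; apply: eq_bigr => s _; rewrite mxE !mulrDl.
Qed.

Lemma cone_ufilt mu y a : Aset a -> cone mu -> cone (ufilt mu y a).
Proof.
move=> Aa c x' s'; rewrite mxE; do 2![apply: sumr_ge0 => ? _].
by rewrite !mulr_ge0 ?ler0n ?Aset_ge0//; case: stQ.
Qed.

(** The rows of [Q] sum to 1 and an admissible output has exactly one next charge; inadmissible
    outputs have [a x s y = 0]. The mass is thus the denominator of [filt]. *)
Lemma mass_ufilt mu y a : Aset a ->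
  mass (ufilt mu y a) = \sum_x \sum_s mu x s * a x s y.
Proof.
move=> Aa; rewrite /mass.
transitivity (\sum_x \sum_s mu x s * a x s y *
    ((\sum_s' (nxt s x y s')%:R) * (\sum_x' Q x x'))).
  under eq_bigr => x' _ do under eq_bigr => s' _ do rewrite mxE pair_big/=.
  rewrite pair_big/= exchange_big/= [RHS]pair_big/=; apply: eq_bigr => -[x s] _ /=.
  rewrite big_distrlr/= [RHS]mulr_sumr -(pair_big xpredT xpredT (fun x' s' =>
    mu x s * a x s y * ((nxt s x y s')%:R * Q x x')))/= exchange_big/=.
  by apply: eq_bigr => s' _; rewrite mulr_sumr.
apply: eq_bigr => x _; apply: eq_bigr => s _; rewrite (stQ.2 x) mulr1 sum_nxt.
by case: (boolP (inYo s x y)) => [_|/(Aset_out Aa) ->]; rewrite ?mulr1 ?mulr0 ?mul0r.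
Qed.

(** The first sum is minus the conditional entropy of the output; the output-entropy term of the
    information is carried by [U]. *)
Definition ucost (U : M -> R) a mu : R :=
  \sum_x \sum_s mu x s * (\sum_y xlnx (a x s y)) + \sum_y U (ufilt mu y a).

(* [uval k mu] is the k-step value function extended to arbitrary matrices; on
   nonnegative ones it equals |mu| V(mu / |mu|) - |mu| ln |mu|. *)
Fixpoint uval (k : nat) : M -> R :=
  match k with
  | 0 => fun mu => - xlnx (mass mu)
  | k'.+1 => fun mu => inf [set ucost (uval k') a mu | a in Aset]
  end.

Local Notation N := #|{: X * S * Y}|.
(** Actions are coded as row vectors to give them a topology in which boxes are compact. *)
Definition dec (v : 'rV[R]_N) x s y : R := v ord0 (enum_rank (x, s, y)).
Definition enc a : 'rV[R]_N :=
  \row_i a (enum_val i).1.1 (enum_val i).1.2 (enum_val i).2.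

Lemma encK a : dec (enc a) = a.
Proof.
by apply/funext => x; apply/funext => s; apply/funext => y;
  rewrite /dec /enc mxE enum_rankK.
Qed.

Lemma dec_continuous x s y : continuous (fun v => dec v x s y).
Proof. exact: coord_continuous. Qed.

Definition Acode : set 'rV[R]_N := [set v | Aset (dec v)].

Lemma Aset_image (F : (X -> S -> Y -> R) -> R) :
  [set F a | a in Aset] = [set F (dec v) | v in Acode].
Proof.
apply/seteqP; split => [_ [a Aa <-]|_ [v Av <-]]; last by exists (dec v).
by exists (enc a); rewrite /Acode /= encK.
Qed.

Lemma Acode_nonempty : Acode !=set0.
Proof. by exists (enc direct); rewrite /Acode /= encK; exact: Aset_direct. Qed.

(** Admissibility is a finite system of closed conditions, and it confines every coordinate to
    [0, 1]. *)
Lemma Acode_compact : compact Acode.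
Proof.
have -> : Acode = \bigcap_(xs in [set: X * S])
   ((\bigcap_(y in [set: Y]) (fun v => dec v xs.1 xs.2 y) @^-1` [set r | 0 <= r])
   `&` (fun v => \sum_y dec v xs.1 xs.2 y) @^-1` [set 1]
   `&` (fun v => \sum_(y | inYo xs.2 xs.1 y) dec v xs.1 xs.2 y) @^-1` [set 1]).
  apply/seteqP; split => [v Av [x s] _|v Av x s].
    by have [[h0 h1] h2] := Av x s; split; [split=> [y _|]|]; [exact: h0|exact: h1|exact: h2].
  have [[h0 h1] h2] := Av (x, s) I.
  by split; [split=> [y|]|]; [exact: h0|exact: h1|exact: h2].
apply: (@subclosed_compact _ _
  [set v : 'rV[R]_N | forall i, `[0, 1]%classic (v ord0 i)]).
- apply: closed_bigI => -[x s] _; apply: closedI; first apply: closedI.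
  + apply: closed_bigI => y _; apply: preimage_closed; last exact: closed_ge.
    by move=> v _; exact: dec_continuous.
  + apply: preimage_closed; last exact: closed_eq.
    by move=> v _; apply: continuous_sum => y _; exact: dec_continuous.
  + apply: preimage_closed; last exact: closed_eq.
    by move=> v _; apply: continuous_sum => y _; exact: dec_continuous.
- exact: (rV_compact (fun=> @segment_compact R 0 1)).
- move=> v Av i.
  move: (Av ((enum_val i).1) I) => [[h1 h2] _] /=; rewrite in_itv/=.
  have pv : is_pmf (dec v (enum_val i).1.1 (enum_val i).1.2).
    by split => [z|//]; exact: h1.
  have <- : dec v (enum_val i).1.1 (enum_val i).1.2 (enum_val i).2 = v ord0 i.
    by rewrite /dec -!surjective_pairing enum_valK.
  by rewrite is_pmf_le1// andbT; case: pv.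
Qed.

Lemma mass_continuous : continuous mass.
Proof. by do 2![apply: continuous_sum => ? _]; exact: coord_continuous. Qed.

(** Continuity is joint in action and belief, as the infimum argument requires. *)
Lemma ucost_continuous U : continuous U ->
  continuous (fun vm : 'rV[R]_N * M => ucost U (dec vm.1) vm.2).
Proof.
move=> cU.
have c1 x s y : continuous (fun vm : 'rV[R]_N * M => dec vm.1 x s y).
  by move=> vm; apply: (@continuous_comp _ _ _ fst (fun v => dec v x s y));
    [exact: cvg_fst|exact: dec_continuous].
have c2 x s : continuous (fun vm : 'rV[R]_N * M => vm.2 x s).
  by move=> vm; apply: (@continuous_comp _ _ _ snd (fun m : M => m x s));
    [exact: cvg_snd|exact: coord_continuous].
move=> vm; apply: cvgD.
  apply: continuous_sum => x _; apply: continuous_sum => s _ {}vm.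
  apply: cvgM; first exact: c2.
  apply: continuous_sum => y _ {}vm.
  by apply: continuous_comp; [exact: c1|exact: xlnx_continuous].
apply: continuous_sum => y _ {}vm.
apply: (continuous_comp (f := fun vm : 'rV[R]_N * M => ufilt vm.2 y (dec vm.1)));
  last exact: cU.
apply: continuous_matrix => x' s'.
rewrite (_ : (fun _ => _) = fun vm : 'rV[R]_N * M => \sum_x \sum_s
    vm.2 x s * dec vm.1 x s y * ((nxt s x y s')%:R * Q x x')); last first.
  by apply/funext => wm; rewrite mxE.
apply: continuous_sum => x _; apply: continuous_sum => s _ {}vm.
apply: cvgM; last exact: cvg_cst.
by apply: cvgM; [exact: c2|exact: c1].
Qed.

Lemma uval_continuous k : continuous (uval k).
Proof.
elim: k => [|k IH] /=.
  have c : continuous (fun mu => xlnx (mass mu)).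
    move=> mu; apply: (@continuous_comp _ _ _ mass (@xlnx R)).
      exact: mass_continuous.
    exact: xlnx_continuous.
  by move=> mu; apply: (cvgN (c mu)).
under eq_fun do rewrite Aset_image.
exact: (inf_compact_continuous Acode_nonempty Acode_compact (ucost_continuous IH)).
Qed.

Lemma uval_attained k mu : exists2 a, Aset a & ucost (uval k) a mu = uval k.+1 mu.
Proof.
have [[v Av vE] _] := inf_compact_attained Acode_nonempty Acode_compact
  (ucost_continuous (@uval_continuous k)) mu.
by exists (dec v) => //=; rewrite Aset_image.
Qed.

Lemma uval_le k mu a : Aset a -> uval k.+1 mu <= ucost (uval k) a mu.
Proof.
move=> Aa.
have [_ /(_ (enc a))] := inf_compact_attained Acode_nonempty Acode_compact
  (ucost_continuous (@uval_continuous k)) mu.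
by rewrite /= encK Aset_image; apply; rewrite /Acode /= encK.
Qed.

Lemma sum_mass_ufilt mu a : Aset a -> \sum_y mass (ufilt mu y a) = mass mu.
Proof.
move=> Aa; under eq_bigr do rewrite mass_ufilt//.
rewrite exchange_big; apply: eq_bigr => x _; rewrite exchange_big.
by apply: eq_bigr => s _; rewrite -mulr_sumr Aset_sum1// mulr1.
Qed.

(** The corrections [xlnx c * mass] of the outputs add up to that of [mu], because an admissible
    action preserves total mass. *)
Lemma ucostZ U c mu a : Aset a -> cone mu ->
  (forall nu, cone nu -> U (c *: nu) = c * U nu - xlnx c * mass nu) ->
  ucost U a (c *: mu) = c * ucost U a mu - xlnx c * mass mu.
Proof.
move=> Aa cmu Uc; rewrite /ucost mulrDr -addrA; congr (_ + _).
  rewrite mulr_sumr; apply: eq_bigr => x _; rewrite mulr_sumr.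
  by apply: eq_bigr => s _; rewrite mxE mulrA.
rewrite -(sum_mass_ufilt mu Aa) !mulr_sumr -sumrB; apply: eq_bigr => y _.
by rewrite ufiltZ Uc//; exact: cone_ufilt.
Qed.

(** The correction term does not involve the action, so [mu] and [c *: mu] compare actions alike.
    The case [c = 0] is included to cover outputs of probability zero. *)
Lemma uvalZ k c mu : 0 <= c -> cone mu ->
  uval k (c *: mu) = c * uval k mu - xlnx c * mass mu.
Proof.
move=> c0; elim: k mu => [|k IH] mu cmu.
  by rewrite /= massZ xlnxM ?mass_ge0//; ring.
apply/eqP; rewrite eq_le; apply/andP; split.
  have [a Aa <-] := uval_attained k mu.
  by rewrite -ucostZ//; exact: uval_le.
have [a Aa <-] := uval_attained k (c *: mu).
by rewrite ucostZ// lerB// ler_wpM2l// uval_le.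
Qed.

(** For a fixed action [ucost] is a linear term plus concave functions of the linear maps [ufilt];
    the minimiser at the mixture is tested at both end points. *)
Lemma uval_concave k mu nu l : cone mu -> cone nu -> 0 <= l <= 1 ->
  l * uval k mu + (1 - l) * uval k nu <= uval k (l *: mu + (1 - l) *: nu).
Proof.
move=> + + l01; have /andP[l0 l1] := l01.
elim: k mu nu => [|k IH] mu nu cmu cnu.
  rewrite /= massD !massZ.
  by have := xlnx_convex (mass_ge0 cmu) (mass_ge0 cnu) l01; lra.
have [a Aa <-] := uval_attained k (l *: mu + (1 - l) *: nu).
apply: (@le_trans _ _ (l * ucost (uval k) a mu + (1 - l) * ucost (uval k) a nu)).
  by apply: lerD; apply: ler_wpM2l; rewrite ?subr_ge0 ?uval_le.
rewrite /ucost !mulrDr addrACA; apply: lerD.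
  rewrite le_eqVlt; apply/orP; left; apply/eqP.
  rewrite !mulr_sumr -big_split; apply: eq_bigr => x _.
  rewrite !mulr_sumr -big_split; apply: eq_bigr => s _ /=.
  by rewrite !mxE; ring.
rewrite !mulr_sumr -big_split; apply: ler_sum => y _ /=.
by rewrite ufiltD !ufiltZ IH//; exact: cone_ufilt.
Qed.

End value.

(** * From unnormalised values back to the Bellman recursion *)

Section bellman.
Variables (R : realType) (mx my ms : nat) (Q : 'M[R]_mx.+1).
Local Notation X := 'I_mx.+1.
Local Notation Y := 'I_my.+1.
Local Notation S := 'I_ms.+1.
Local Notation M := 'M[R]_(mx.+1, ms.+1).
Variable phi0 : M -> Y -> (X -> S -> Y -> R) -> M.
Implicit Types (x : X) (y : Y) (s : S) (pi : M) (a : X -> S -> Y -> R).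

Lemma shift_nxt (F : S -> R) (s' : S) x y :
  (if Defs.shift s' x y is Some s then F s else 0) = \sum_s F s * (nxt s x y s')%:R.
Proof.
rewrite /Defs.shift; case: leqP => [le|lt].
  case: insubP => [s _ /= e|h].
    rewrite (bigD1 s)//= big1 => [|t ts].
      by rewrite /nxt; case: eqP => [_|[]]; [rewrite mulr1 addr0|lia].
    rewrite /nxt; case: eqP; rewrite ?mulr0// => e'; case/eqP: ts.
    by apply/val_inj => /=; lia.
  rewrite big1// => s _; rewrite /nxt; case: eqP; rewrite ?mulr0// => e.
  by exfalso; have := ltn_ord s; move: h; lia.
rewrite big1// => s _; rewrite /nxt; case: eqP; rewrite ?mulr0// => e.
by exfalso; have := ltn_ord s; lia.
Qed.

Hypothesis mxy : (mx <= my)%N.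
Hypothesis stQ : stochastic Q.
Hypothesis phi0_simplex : forall pi y a, simplex (phi0 pi y a).

Lemma filt_ufilt pi y a : Aset a -> mass (ufilt Q pi y a) != 0 ->
  filt Q phi0 pi y a = (mass (ufilt Q pi y a))^-1 *: ufilt Q pi y a.
Proof.
move=> Aa; rewrite /filt mass_ufilt//.
have -> : \sum_x \sum_s a x s y * pi x s = \sum_x \sum_s pi x s * a x s y.
  by apply: eq_bigr => x _; apply: eq_bigr => s _; rewrite mulrC.
move=> D0; rewrite (negbTE D0); apply/matrixP => x' s'; rewrite !mxE mulrC.
congr (_ * _); apply: eq_bigr => x _; rewrite shift_nxt mulr_sumr.
by apply: eq_bigr => s _; ring.
Qed.

(** Valid also at mass zero: a nonnegative matrix of mass zero is zero, whatever pmf [filt] then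
    returns. *)
Lemma ufilt_filt pi y a : Aset a -> cone pi ->
  ufilt Q pi y a = mass (ufilt Q pi y a) *: filt Q phi0 pi y a.
Proof.
move=> Aa cpi; have [m0|m0] := eqVneq (mass (ufilt Q pi y a)) 0.
  by rewrite m0 scale0r (mass_eq0 _ m0)//; exact: cone_ufilt.
by rewrite filt_ufilt// scalerA mulfV// scale1r.
Qed.

Lemma filt_simplex pi y a : Aset a -> cone pi -> simplex (filt Q phi0 pi y a).
Proof.
move=> Aa cpi; have cu : cone (ufilt Q pi y a) by exact: cone_ufilt.
have [m0|m0] := eqVneq (mass (ufilt Q pi y a)) 0.
  have D0 : \sum_x \sum_s a x s y * pi x s = 0.
    rewrite -[RHS]m0 mass_ufilt//; apply: eq_bigr => x _.
    by apply: eq_bigr => s _; rewrite mulrC.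
  by rewrite /filt D0 eqxx.
rewrite filt_ufilt//; split => [x s|].
  by rewrite mxE mulr_ge0// invr_ge0 mass_ge0.
by rewrite -/(mass _) massZ mulVf.
Qed.

(** By the product rule [xlnxM], the joint term contains [xlnx (pi x s)], which cancels against the
    marginal of the state. *)
Lemma Iap_xlnx pi a : simplex pi -> Aset a ->
  Iap a pi = \sum_x \sum_s pi x s * (\sum_y xlnx (a x s y))
             - \sum_y xlnx (mass (ufilt Q pi y a)).
Proof.
move=> [cpi pi1] Aa; rewrite /Iap mutinf_xlnx => [|[x s] y /=]; last first.
  by rewrite mulr_ge0 ?Aset_ge0.
congr (_ - _); last first.
  by apply: eq_bigr => y _; rewrite mass_ufilt// pair_big.
rewrite -sumrB pair_big/=; apply: eq_bigr => -[x s] _ /=.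
rewrite -mulr_sumr Aset_sum1// mulr1.
under eq_bigr do rewrite xlnxM ?Aset_ge0//.
by rewrite big_split/= -mulr_sumr -mulr_suml Aset_sum1//; ring.
Qed.

(** For an output of probability [m], homogeneity gives [U (ufilt) = m * V (filt) - xlnx m]; the
    last term is the output-entropy part of the information. *)
Lemma bell_ucost (V : M -> R) k pi a : simplex pi -> Aset a ->
  (forall p, simplex p -> V p = uval my Q k p) ->
  bell Q phi0 a V pi = ucost Q (uval my Q k) a pi.
Proof.
move=> spi Aa VU; have [cpi pi1] := spi.
rewrite /bell (Iap_xlnx spi Aa) /ucost -addrA; congr (_ + _).
have -> : \sum_x \sum_s \sum_y pi x s * a x s y * V (filt Q phi0 pi y a)
    = \sum_y mass (ufilt Q pi y a) * V (filt Q phi0 pi y a).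
  rewrite pair_big/= exchange_big/=; apply: eq_bigr => y _.
  by rewrite -mulr_suml mass_ufilt// pair_big.
rewrite addrC -sumrB; apply: eq_bigr => y _.
have sf := filt_simplex y Aa cpi.
rewrite (VU _ sf) [in RHS](ufilt_filt y Aa cpi).
rewrite uvalZ//; [|exact/mass_ge0/cone_ufilt|by case: sf].
by rewrite (_ : mass (filt _ _ _ _ _) = 1) ?mulr1//; case: sf.
Qed.

Lemma Vrem_uval k pi : simplex pi -> Vrem Q phi0 k pi = uval my Q k pi.
Proof.
elim: k pi => [|k IH] pi spi /=.
  by case: (spi) => _; rewrite -/(mass pi) => ->; rewrite xlnx1 oppr0.
congr inf; apply/seteqP; split => _ [a Aa <-]; exists a => //.
  by rewrite (@bell_ucost _ k).
by rewrite (@bell_ucost _ k).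
Qed.

Lemma concave_Vrem k : concave_on simplex (Vrem Q phi0 k).
Proof.
move=> p1 p2 l s1 s2 l01; have [[c1 m1] [c2 m2]] := (s1, s2).
have /andP[l0 l1] := l01.
rewrite !Vrem_uval//; first exact: uval_concave.
split => [x s|]; first by rewrite !mxE addr_ge0 ?mulr_ge0 ?subr_ge0.
by rewrite -/(mass _) massD !massZ /mass m1 m2; ring.
Qed.

Lemma continuous_Vrem k : {within simplex, continuous (Vrem Q phi0 k)}.
Proof.
apply: (@subspace_eq_continuous _ _ _ (uval my Q k) (Vrem Q phi0 k)).
  by move=> p; rewrite inE => sp; apply/esym; exact: Vrem_uval.
exact/continuous_subspaceT/uval_continuous.
Qed.

Lemma bell_attained k pi : simplex pi ->
  exists a, Aset a /\ bell Q phi0 a (Vrem Q phi0 k) pi = Vrem Q phi0 k.+1 pi.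
Proof.
move=> spi; have [a Aa E] := uval_attained Q mxy k pi.
exists a; split => //; rewrite [RHS]Vrem_uval// -E; apply: bell_ucost => //.
exact: Vrem_uval.
Qed.

Lemma Vrem_le k pi a : simplex pi -> Aset a ->
  Vrem Q phi0 k.+1 pi <= bell Q phi0 a (Vrem Q phi0 k) pi.
Proof.
move=> spi Aa; rewrite [leLHS]Vrem_uval// (@bell_ucost _ k)//.
  exact: uval_le.
exact: Vrem_uval.
Qed.

End bellman.

(** * Finite words, their prefixes and one-letter extensions *)

Section words.
Variable m : nat.
Local Notation A := 'I_m.+1.

Definition snoc n (f : {ffun 'I_n -> A}) (a : A) : {ffun 'I_n.+1 -> A} :=
  [ffun i : 'I_n.+1 => if (i < n)%N then tat f i else a].

Lemma tat_ord n (f : {ffun 'I_n -> A}) (i : 'I_n) : tat f i = f i.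
Proof. by rewrite /tat valK. Qed.

Lemma tat_max n (f : {ffun 'I_n.+1 -> A}) : tat f n = f ord_max.
Proof. by rewrite -tat_ord. Qed.

Lemma tat_pre n (f : {ffun 'I_n -> A}) k i : (i < k)%N ->
  tat (pre f k) i = tat f i.
Proof. by move=> ik; rewrite -[i]/(val (Ordinal ik)) tat_ord ffunE. Qed.

Lemma pre_pre n (f : {ffun 'I_n -> A}) k l : (l <= k)%N ->
  pre (pre f k) l = pre f l.
Proof.
move=> lk; apply/ffunP => i; rewrite !ffunE tat_pre//.
exact: leq_trans (ltn_ord i) lk.
Qed.

Lemma pre_id n (f : {ffun 'I_n -> A}) : pre f n = f.
Proof. by apply/ffunP => i; rewrite ffunE tat_ord. Qed.

Lemma tat_snoc n (f : {ffun 'I_n -> A}) a i : (i < n)%N ->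
  tat (snoc f a) i = tat f i.
Proof.
move=> ni; have ni1 : (i < n.+1)%N by rewrite ltnS ltnW.
by rewrite -[i]/(val (Ordinal ni1)) tat_ord ffunE /= ni.
Qed.

Lemma snoc_max n (f : {ffun 'I_n -> A}) a : snoc f a ord_max = a.
Proof. by rewrite ffunE /= ltnn. Qed.

Lemma tat_snoc_max n (f : {ffun 'I_n -> A}) a : tat (snoc f a) n = a.
Proof. by rewrite tat_max snoc_max. Qed.

Lemma pre_snoc n (f : {ffun 'I_n -> A}) a : pre (snoc f a) n = f.
Proof. by apply/ffunP => i; rewrite ffunE tat_snoc// tat_ord. Qed.

Lemma snoc_pre n (f : {ffun 'I_n.+1 -> A}) : snoc (pre f n) (f ord_max) = f.
Proof.
apply/ffunP => i; rewrite ffunE; case: ltnP => ni.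
  by rewrite tat_pre// tat_ord.
by congr (f _); apply/val_inj/eqP; rewrite /= eqn_leq ni -ltnS ltn_ord.
Qed.

Lemma big_snoc (R : zmodType) n (F : {ffun 'I_n.+1 -> A} -> R) :
  \sum_f F f = \sum_g \sum_a F (snoc g a).
Proof.
rewrite pair_big/= (reindex (fun p : {ffun 'I_n -> A} * A => snoc p.1 p.2))//=.
exists (fun f => (pre f n, f ord_max)) => [[g a]|f] _ /=.
  by rewrite pre_snoc snoc_max.
by rewrite snoc_pre.
Qed.

Lemma big_ffun0 (R : zmodType) (F : {ffun 'I_0 -> A} -> R) f0 :
  \sum_f F f = F f0.
Proof.
rewrite (bigD1 f0)//= big1 ?addr0// => f; case/eqP.
by apply/ffunP => -[].
Qed.

End words.

Lemma partition_weights (R : comNzRingType) (I J : finType) (g : I -> J)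
    (w : I -> R) (F : J -> R) :
  \sum_i w i * F (g i) = \sum_j (\sum_(i | g i == j) w i) * F j.
Proof.
rewrite (partition_big g xpredT)//=; apply: eq_bigr => j _.
by rewrite mulr_suml; apply: eq_bigr => i /eqP ->.
Qed.

(** With at most one nonzero term both sides reduce to it, as [xlnx 0 = 0]. Applied to sums over
    charge paths. *)
Lemma xlnx_sum_unique (R : realType) (I : finType) (P : pred I) (w : I -> R) :
  (forall i j, P i -> P j -> w i != 0 -> w j != 0 -> i = j) ->
  xlnx (\sum_(i | P i) w i) = \sum_(i | P i) xlnx (w i).
Proof.
move=> uniq; case: (pickP [pred i | P i && (w i != 0)]) => [i /andP[Pi wi]|w0].
  have w0 j : P j && (j != i) -> w j = 0.
    case/andP=> Pj /eqP ji; apply/eqP/negPn/negP => wj; apply: ji.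
    exact: uniq.
  rewrite (bigD1 i)//= [in RHS](bigD1 i)//= !big1 ?addr0// => j /w0 //.
  by move=> ->; exact: xlnx0.
have {}w0 j : P j -> w j = 0.
  by move=> Pj; have := w0 j; rewrite /= Pj /= => /negbFE/eqP.
by rewrite !big1 ?xlnx0// => j /w0 // ->; exact: xlnx0.
Qed.

(** * Lower bound on the leakage of an arbitrary policy *)

Section trajectories.
Variables (R : realType) (mx my ms : nat) (Q : 'M[R]_mx.+1).
Variables (PX1 : 'I_mx.+1 -> R) (PS1 : 'I_ms.+1 -> R) (q : policy R mx my ms).
Local Notation X := 'I_mx.+1.
Local Notation Y := 'I_my.+1.
Local Notation S := 'I_ms.+1.
Local Notation M := 'M[R]_(mx.+1, ms.+1).
Local Notation H t := ({ffun 'I_t.+1 -> X} * {ffun 'I_t.+1 -> S})%type.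

Hypothesis stQ : stochastic Q.
Hypothesis pmfX : is_pmf PX1.
Hypothesis pmfS : is_pmf PS1.
Hypothesis QAq : QA q.

(* Joint law of the demands and charges up to the (0-based) time t and of the
   t outputs emitted strictly before. *)
Fixpoint nu (t : nat) : H t -> {ffun 'I_t -> Y} -> R :=
  match t with
  | 0 => fun h _ => PS1 (h.2 ord_max) * PX1 (h.1 ord_max)
  | t'.+1 => fun h ys =>
      let xs := pre h.1 t'.+1 in let ss := pre h.2 t'.+1 in
      nu (xs, ss) (pre ys t') * q xs ss (pre ys t') (ys ord_max) *
      ((nxt (ss ord_max) (xs ord_max) (ys ord_max) (h.2 ord_max))%:R
       * Q (xs ord_max) (h.1 ord_max))
  end.

Lemma nuS t xs ss ys x s y :
  nu (t := t.+1) (snoc xs x, snoc ss s) (snoc ys y) =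
  nu (xs, ss) ys * q xs ss ys y *
  ((nxt (ss ord_max) (xs ord_max) y s)%:R * Q (xs ord_max) x).
Proof. by rewrite /= !pre_snoc !snoc_max. Qed.

Lemma nuE t xs ss ys : nu (t := t) (xs, ss) ys =
  PS1 (tat ss 0) * PX1 (tat xs 0) *
  (\prod_(j < t) q (pre xs j.+1) (pre ss j.+1) (pre ys j) (tat ys j)) *
  \prod_(1 <= j < t.+1)
     ((nxt (tat ss j.-1) (tat xs j.-1) (tat ys j.-1) (tat ss j))%:R
      * Q (tat xs j.-1) (tat xs j)).
Proof.
elim: t xs ss ys => [|t IH] xs ss ys.
  by rewrite /= big_ord0 big_geq// !mulr1 -!tat_max.
rewrite big_ord_recr/= [in RHS]big_nat_recr//= IH !tat_pre//.
rewrite -!tat_max !tat_pre//.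
have -> : \prod_(j < t) q (pre (pre xs t.+1) j.+1) (pre (pre ss t.+1) j.+1)
    (pre (pre ys t) j) (tat (pre ys t) j) =
   \prod_(j < t) q (pre xs j.+1) (pre ss j.+1) (pre ys j) (tat ys j).
  by apply: eq_bigr => j _; rewrite !pre_pre ?tat_pre//; have := ltn_ord j; lia.
rewrite [X in _ * X * _ * _](_ : _ = \prod_(1 <= j < t.+1)
     ((nxt (tat ss j.-1) (tat xs j.-1) (tat ys j.-1) (tat ss j))%:R
      * Q (tat xs j.-1) (tat xs j))); last first.
  apply: eq_big_nat => -[|j]//= jt; rewrite !tat_pre//; exact: ltnW.
ring.
Qed.

(** [nu] stops just before the last output, so the full law has one more policy factor. *)
Lemma law_nu t (xs : {ffun 'I_t.+1 -> X}) (ss : {ffun 'I_t.+1 -> S})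
    (ys : {ffun 'I_t -> Y}) y :
  law Q PX1 PS1 q ss xs (snoc ys y) = nu (xs, ss) ys * q xs ss ys y.
Proof.
rewrite /law nuE big_ord_recr /= !pre_id pre_snoc snoc_max.
have -> : \prod_(j < t) q (pre xs (widen_ord (leqnSn t) j).+1)
    (pre ss (widen_ord (leqnSn t) j).+1)
    (pre (snoc ys y) (widen_ord (leqnSn t) j))
    (snoc ys y (widen_ord (leqnSn t) j)) =
   \prod_(j < t) q (pre xs j.+1) (pre ss j.+1) (pre ys j) (tat ys j).
  apply: eq_bigr => j _ /=; congr (q _ _ _ _); last by rewrite ffunE /= ltn_ord.
  by rewrite -{2}[ys](pre_snoc ys y) pre_pre// ltnW.
have -> : \prod_(1 <= j < t.+1)
     ((Posz (tat ss j) == Posz (tat ss j.-1) - Posz (tat xs j.-1)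
         + Posz (tat (snoc ys y) j.-1))%:R * Q (tat xs j.-1) (tat xs j)) =
   \prod_(1 <= j < t.+1)
     ((nxt (tat ss j.-1) (tat xs j.-1) (tat ys j.-1) (tat ss j))%:R
      * Q (tat xs j.-1) (tat xs j)).
  by apply: eq_big_nat => -[|j]//= jt; rewrite tat_snoc.
ring.
Qed.

Lemma q_ge0 t xs ss ys y : 0 <= q (t := t) xs ss ys y.
Proof. by have [[]] := QAq xs ss ys. Qed.

Lemma q_sum1 t xs ss ys : \sum_y q (t := t) xs ss ys y = 1.
Proof. by have [[]] := QAq xs ss ys. Qed.

Lemma q_out t (xs : {ffun 'I_t.+1 -> X}) (ss : {ffun 'I_t.+1 -> S})
    ys y : ~~ inYo (ss ord_max) (xs ord_max) y ->
  q (t := t) xs ss ys y = 0.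
Proof. by have [pq q1] := QAq xs ss ys; apply: is_pmf_out. Qed.

Lemma nu_ge0 t h ys : 0 <= nu (t := t) h ys.
Proof.
elim: t h ys => [|t IH] h ys /=.
  by apply: mulr_ge0; [case: pmfS|case: pmfX].
by rewrite !mulr_ge0 ?ler0n ?q_ge0//; case: stQ.
Qed.

Arguments nu : simpl never.

Definition lst t (h : H t) : X * S := (h.1 ord_max, h.2 ord_max).

(** The belief state multiplied by the probability of the past outputs. *)
Definition mu t (ys : {ffun 'I_t -> Y}) : M :=
  \matrix_(x, s) \sum_(h | lst h == (x, s)) nu h ys.

Lemma cone_mu t (ys : {ffun 'I_t -> Y}) : cone (mu ys).
Proof. by move=> x s; rewrite mxE sumr_ge0// => h _; exact: nu_ge0. Qed.

Lemma sum_lst t (w : H t -> R) (F : X -> S -> R) :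
  \sum_h w h * F (h.1 ord_max) (h.2 ord_max) =
  \sum_x \sum_s (\sum_(h | lst h == (x, s)) w h) * F x s.
Proof.
rewrite (partition_weights (@lst t) w (fun xs => F xs.1 xs.2)).
by rewrite pair_big/=; apply: eq_bigr => -[x s].
Qed.

Lemma sum_lst1 t (w : H t -> R) :
  \sum_h w h = \sum_x \sum_s \sum_(h | lst h == (x, s)) w h.
Proof.
rewrite (partition_big (@lst t) xpredT)//= pair_big/=.
by apply: eq_bigr => -[x s].
Qed.

(* [a] is the conditional law of the output given the current demand, the
   current charge and the past outputs. *)
Definition cond_action t (ys : {ffun 'I_t -> Y}) (a : X -> S -> Y -> R) :=
  forall x s y, mu ys x s * a x s y =
    \sum_(h | lst h == (x, s)) nu h ys * q h.1 h.2 ys y.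

(** The next demand and charge depend on the hidden past only through the current pair and the
    output, so only the conditional law [a] matters. *)
Lemma mu_snoc t (ys : {ffun 'I_t -> Y}) a y :
  cond_action ys a -> mu (snoc ys y) = ufilt Q (mu ys) y a.
Proof.
move=> ca; apply/matrixP => x' s'; rewrite [RHS]mxE.
under [RHS]eq_bigr do under eq_bigr do rewrite ca.
rewrite -(sum_lst (fun h => nu h ys * q h.1 h.2 ys y)
  (fun x s => (nxt s x y s')%:R * Q x x')).
(* Split each longer history into its prefix and its last pair, which is fixed to [(x', s')]. *)
rewrite mxE (reindex (fun p : H t * (X * S) =>
  (snoc p.1.1 p.2.1, snoc p.1.2 p.2.2)))/=; last first.
  exists (fun h => ((pre h.1 t.+1, pre h.2 t.+1), lst h)).
    by move=> [[xs ss] [x s]] _; rewrite /lst /= !pre_snoc !snoc_max.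
  by move=> [xs ss] _; rewrite /lst /= !snoc_pre.
rewrite (eq_bigl (fun p : H t * (X * S) => xpredT p.1 && (p.2 == (x', s')))).
  rewrite -(pair_big xpredT (fun xs => xs == (x', s')) (fun (h : H t) xs =>
    nu (t := t.+1) (snoc h.1 xs.1, snoc h.2 xs.2) (snoc ys y))).
  by apply: eq_bigr => -[xs ss] _; rewrite big_pred1_eq nuS.
by move=> [[xs ss] [x s]]; rewrite /lst /= !snoc_max.
Qed.

Hypothesis mxy : (mx <= my)%N.

(** On states of mass zero the quotient is meaningless, and [direct] keeps the action admissible. *)
Definition avg t (ys : {ffun 'I_t -> Y}) x s y : R :=
  if mu ys x s == 0 then direct R mxy x s y
  else (\sum_(h | lst h == (x, s)) nu h ys * q h.1 h.2 ys y) / mu ys x s.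

Lemma cond_action_avg t (ys : {ffun 'I_t -> Y}) : cond_action ys (avg ys).
Proof.
move=> x s y; rewrite /avg; case: eqP => [m0|/eqP m0]; last first.
  by rewrite mulrC divfK.
rewrite m0 mul0r big1// => h hxs; move: m0; rewrite mxE => /eqP.
rewrite psumr_eq0 => [/allP/(_ h)|? _]; last exact: nu_ge0.
by rewrite mem_index_enum hxs => /(_ isT)/eqP ->; rewrite mul0r.
Qed.

Lemma Aset_avg t (ys : {ffun 'I_t -> Y}) : Aset (avg ys).
Proof.
move=> x s; rewrite /avg; case: eqP => [_|/eqP m0]; first exact: Aset_direct.
have sum1 (P : pred Y) : (forall xs ss, lst (t := t) (xs, ss) = (x, s) ->
      \sum_(y | P y) q xs ss ys y = 1) ->
    \sum_(y | P y) (\sum_(h | lst h == (x, s)) nu h ys * q h.1 h.2 ys y)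
      / mu ys x s = 1.
  move=> P1; rewrite -mulr_suml exchange_big/=.
  rewrite (eq_bigr (fun h => nu h ys)) => [|[xs ss] /eqP hxs]; last first.
    by rewrite -mulr_sumr P1// mulr1.
  by move: m0; rewrite mxE => m0; rewrite mulfV.
split; [split=> [y|]|].
- rewrite mulr_ge0// ?invr_ge0 ?cone_mu// sumr_ge0// => h _.
  by rewrite mulr_ge0 ?nu_ge0 ?q_ge0.
- by apply: sum1 => xs ss _; exact: q_sum1.
- by apply: sum1 => xs ss [<- <-]; have [] := QAq xs ss ys.
Qed.

Definition cost t : R :=
  \sum_(ys : {ffun 'I_t -> Y}) \sum_h nu h ys * \sum_y xlnx (q h.1 h.2 ys y).

Lemma costE t : cost t = \sum_xs \sum_ss \sum_ys
  nu (t := t) (xs, ss) ys * \sum_y xlnx (q xs ss ys y).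
Proof.
by rewrite /cost exchange_big/= [RHS]pair_big/=; apply: eq_bigr => -[xs ss].
Qed.

Lemma mu0 ys : mu (t := 0) ys = pi1 PX1 PS1.
Proof.
apply/matrixP => x s; rewrite !mxE.
rewrite (big_pred1 ([ffun=> x], [ffun=> s])) => [/=|[xs ss]].
  by rewrite /nu /= !ffunE mulrC.
rewrite /lst /= !xpair_eqE; congr (_ && _).
  apply/eqP/eqP => [e|->]; last by rewrite ffunE.
  by apply/ffunP => i; rewrite ffunE -e; congr (xs _); apply/val_inj; case: i => -[].
apply/eqP/eqP => [e|->]; last by rewrite ffunE.
by apply/ffunP => i; rewrite ffunE -e; congr (ss _); apply/val_inj; case: i => -[].
Qed.

(* Jensen: averaging the policy over the hidden past keeps the flow of the
   unnormalised beliefs and can only decrease the stage cost. *)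
Lemma uval_step_le k t (ys : {ffun 'I_t -> Y}) :
  uval my Q k.+1 (mu ys) <=
  \sum_h nu h ys * (\sum_y xlnx (q h.1 h.2 ys y))
  + \sum_y uval my Q k (mu (snoc ys y)).
Proof.
apply: (le_trans (uval_le Q mxy k (mu ys) (Aset_avg ys))).
rewrite /ucost; apply: lerD; last first.
  apply: ler_sum => y _; rewrite -mu_snoc//; exact: cond_action_avg.
rewrite (partition_big (@lst t) xpredT)//= pair_big/=.
apply: ler_sum => -[x s] _ /=; rewrite mulr_sumr.
under eq_bigr do rewrite mulr_sumr; rewrite exchange_big/=.
apply: ler_sum => y _; have ca := cond_action_avg ys x s y.
move: ca; rewrite mxE => ca; apply: xlnx_jensen.
- by move=> h _; exact: nu_ge0.
- by move=> h _; exact: q_ge0.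
- by apply: Aset_ge0; exact: Aset_avg.
- by rewrite ca.
Qed.

(** Induction on [t] with [k] free: each step trades one stage of the continuation value for one
    stage cost. *)
Lemma uval_le_costs t k :
  uval my Q (t + k) (pi1 PX1 PS1) <=
  \sum_(j < t) cost j + \sum_(ys : {ffun 'I_t -> Y}) uval my Q k (mu ys).
Proof.
elim: t k => [|t IH] k.
  by rewrite big_ord0 add0r (big_ffun0 _ [ffun=> ord0]) mu0.
rewrite addSnnS (le_trans (IH k.+1))// big_ord_recr/= -addrA lerD2l.
rewrite big_snoc /cost -big_split; apply: ler_sum => ys _.
exact: uval_step_le.
Qed.

Definition pX t (xs : {ffun 'I_t.+1 -> X}) (s1 : S) : R :=
  \sum_(ss : {ffun 'I_t.+1 -> S} | tat ss 0 == s1) \sum_ys nu (xs, ss) ys.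

Lemma pX_ge0 t xs s1 : 0 <= pX (t := t) xs s1.
Proof. by do 2![apply: sumr_ge0 => ? _]; exact: nu_ge0. Qed.

Lemma sum_pX t (c : {ffun 'I_t.+1 -> X} -> R) :
  \sum_xs \sum_s1 pX xs s1 * c xs = \sum_xs \sum_ss \sum_ys nu (xs, ss) ys * c xs.
Proof.
apply: eq_bigr => xs _; rewrite [RHS](partition_big (fun ss => tat ss 0) xpredT)//=.
apply: eq_bigr => s1 _; rewrite mulr_suml.
by apply: eq_bigr => ss _; rewrite mulr_suml.
Qed.

Lemma q_inYo t (xs : {ffun 'I_t.+1 -> X}) (ss : {ffun 'I_t.+1 -> S})
    ys y :
  q (t := t) xs ss ys y * (inYo (ss ord_max) (xs ord_max) y)%:R = q xs ss ys y.
Proof.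
case: (boolP (inYo _ _ _)) => [_|/q_out ->]; first by rewrite mulr1.
by rewrite mul0r.
Qed.

(** The demand evolves autonomously: the next charge and the output sum out to 1, since the policy
    only uses admissible outputs. *)
Lemma pX_snoc t xs s1 x :
  pX (t := t.+1) (snoc xs x) s1 = pX xs s1 * Q (xs ord_max) x.
Proof.
rewrite /pX big_mkcond big_snoc [in RHS]big_mkcond mulr_suml.
apply: eq_bigr => ss _.
under eq_bigr do rewrite tat_snoc//.
case: ifP => _; last by rewrite mul0r big1.
under eq_bigr do rewrite big_snoc.
rewrite exchange_big mulr_suml; apply: eq_bigr => ys _ /=.
rewrite exchange_big/=.
transitivity (\sum_y nu (xs, ss) ys * Q (xs ord_max) x * q xs ss ys y).
  apply: eq_bigr => y _; rewrite -[in RHS]q_inYo -sum_nxt !mulr_sumr.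
  by apply: eq_bigr => s _; rewrite nuS; ring.
by rewrite -mulr_sumr q_sum1 mulr1.
Qed.

Lemma sum_xlnx_nu_q t xs ss ys :
  \sum_y xlnx (nu (t := t) (xs, ss) ys * q xs ss ys y) =
  nu (xs, ss) ys * \sum_y xlnx (q xs ss ys y) + xlnx (nu (xs, ss) ys).
Proof.
under eq_bigr do rewrite xlnxM ?nu_ge0 ?q_ge0//.
by rewrite big_split/= -mulr_sumr -mulr_suml q_sum1 mul1r.
Qed.

(** Chain rule for one transition: the next charge is deterministic and adds no entropy, so only the
    row of [Q] contributes. *)
Lemma sum_xlnx_nuS t xs ss ys y :
  \sum_x \sum_s xlnx (nu (t := t.+1) (snoc xs x, snoc ss s) (snoc ys y)) =
  nu (xs, ss) ys * q xs ss ys y * (\sum_x xlnx (Q (xs ord_max) x))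
  + xlnx (nu (xs, ss) ys * q xs ss ys y).
Proof.
set w := nu _ _ * _.
have w0 : 0 <= w by rewrite mulr_ge0 ?nu_ge0 ?q_ge0.
have wi : w * (inYo (ss ord_max) (xs ord_max) y)%:R = w.
  by rewrite /w -mulrA q_inYo.
have lwi : xlnx w * (inYo (ss ord_max) (xs ord_max) y)%:R = xlnx w.
  by rewrite /xlnx mulrAC wi.
have [Q0 Q1] := stQ.
transitivity (\sum_x (w * xlnx (Q (xs ord_max) x) + xlnx w * Q (xs ord_max) x)).
  apply: eq_bigr => x _.
  (* The indicator [nxt] is 0 or 1 and [xlnx 0 = 0], so it can be pulled out of [xlnx]. *)
  transitivity (\sum_s (w * xlnx (Q (xs ord_max) x) + xlnx w * Q (xs ord_max) x)
      * (nxt (ss ord_max) (xs ord_max) y s)%:R).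
    apply: eq_bigr => s _; rewrite nuS -/w; case: nxt.
      by rewrite mul1r mulr1 xlnxM//; ring.
    by rewrite mul0r !mulr0 xlnx0.
  by rewrite -mulr_sumr sum_nxt mulrDl mulrAC wi (mulrAC (xlnx w)) lwi.
by rewrite big_split/= -mulr_sumr -mulr_sumr Q1 mulr1.
Qed.

(** Chain rule over time. Each step adds a policy term and a demand term to the first sum; the
    second sum grows by the same demand term, which cancels. *)
Lemma sum_costs t : \sum_(j < t) cost j =
  \sum_xs \sum_ss \sum_ys xlnx (nu (t := t) (xs, ss) ys)
  - \sum_xs \sum_s1 xlnx (pX (t := t) xs s1).
Proof.
elim: t => [|t IH].
  rewrite big_ord0; apply/esym/eqP; rewrite subr_eq0; apply/eqP.
  apply: eq_bigr => xs _; rewrite big_snoc (big_ffun0 _ [ffun=> ord0]).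
  apply: eq_bigr => s1 _; rewrite (big_ffun0 _ [ffun=> ord0]) /pX.
  rewrite big_mkcond big_snoc (big_ffun0 _ [ffun=> ord0]) -big_mkcond/=.
  under eq_bigl do rewrite tat_snoc_max.
  by rewrite big_pred1_eq (big_ffun0 _ [ffun=> ord0]).
have -> : \sum_xs \sum_ss \sum_ys xlnx (nu (t := t.+1) (xs, ss) ys)
  = \sum_xs \sum_ss \sum_ys (nu (t := t) (xs, ss) ys * \sum_x xlnx (Q (xs ord_max) x)
     + (nu (xs, ss) ys * (\sum_y xlnx (q xs ss ys y)) + xlnx (nu (xs, ss) ys))).
  rewrite big_snoc; apply: eq_bigr => xs _.
  under eq_bigr do rewrite big_snoc; rewrite exchange_big; apply: eq_bigr => ss _ /=.
  under eq_bigr do under eq_bigr do rewrite big_snoc.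
  under eq_bigr do rewrite exchange_big; rewrite exchange_big; apply: eq_bigr => ys _ /=.
  under eq_bigr do rewrite exchange_big; rewrite exchange_big /=.
  under eq_bigr do rewrite sum_xlnx_nuS.
  by rewrite big_split/= sum_xlnx_nu_q -mulr_suml -mulr_sumr q_sum1 mulr1.
have -> : \sum_xs \sum_s1 xlnx (pX (t := t.+1) xs s1)
  = \sum_xs \sum_ss \sum_ys nu (t := t) (xs, ss) ys * (\sum_x xlnx (Q (xs ord_max) x))
    + \sum_xs \sum_s1 xlnx (pX (t := t) xs s1).
  rewrite -sum_pX -big_split big_snoc; apply: eq_bigr => xs _ /=.
  rewrite -big_split exchange_big; apply: eq_bigr => s1 _ /=.
  have [Q0 Q1] := stQ.
  under eq_bigr do rewrite pX_snoc xlnxM ?pX_ge0//.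
  by rewrite big_split/= -mulr_sumr -mulr_suml Q1 mul1r.
rewrite big_ord_recr/= IH costE.
have D3 (F G : {ffun 'I_t.+1 -> X} -> {ffun 'I_t.+1 -> S} ->
    {ffun 'I_t -> Y} -> R) : \sum_xs \sum_ss \sum_ys (F xs ss ys + G xs ss ys) =
    \sum_xs \sum_ss \sum_ys F xs ss ys + \sum_xs \sum_ss \sum_ys G xs ss ys.
  rewrite -big_split; apply: eq_bigr => xs _; rewrite -big_split.
  by apply: eq_bigr => ss _; rewrite -big_split.
by rewrite !D3; ring.
Qed.

(** On the support of [nu], the charge recursion fixes the whole path from its first value. *)
Lemma nu_unique t xs ss ss' ys : tat ss 0 = tat ss' 0 ->
  nu (t := t) (xs, ss) ys != 0 -> nu (t := t) (xs, ss') ys != 0 -> ss = ss'.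
Proof.
elim: t xs ss ss' ys => [|t IH] xs ss ss' ys e0.
  move=> _ _; apply/ffunP => i; rewrite -!tat_ord.
  by rewrite (_ : nat_of_ord i = 0)//; case: i => -[].
rewrite -[xs]snoc_pre -[ys]snoc_pre -[ss]snoc_pre -[ss']snoc_pre !nuS.
rewrite !mulf_eq0 !negb_or => /andP[/andP[n1 _] /andP[x1 _]].
move=> /andP[/andP[n2 _] /andP[x2 _]].
have e : pre ss t.+1 = pre ss' t.+1.
  by apply: (IH _ _ _ _ _ n1 n2); rewrite !tat_pre.
rewrite e in x1 *; congr snoc; apply/val_inj.
move: x1 x2; rewrite !pnatr_eq0 !eqb0 !negbK => /eqP e1 /eqP e2.
by case: (etrans e1 (esym e2)).
Qed.

Lemma sum_init_charge (t : nat) (F : {ffun 'I_t.+1 -> S} -> R) :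
  \sum_s1 \sum_(ss | tat ss 0 == s1) F ss = \sum_ss F ss.
Proof. by rewrite [RHS](partition_big (fun ss => tat ss 0) xpredT). Qed.

Lemma leak_costs t : leak Q PX1 PS1 t.+1 q =
  (\sum_(j < t.+1) cost j
   + \sum_(ys : {ffun 'I_t.+1 -> Y}) uval my Q 0 (mu ys)) / t.+1%:R.
Proof.
rewrite /leak; congr (_ / _); rewrite mutinf_xlnx => [|[xs s1] ys /=]; last first.
  rewrite sumr_ge0// => ss _; rewrite -[ys]snoc_pre law_nu.
  by rewrite mulr_ge0 ?nu_ge0 ?q_ge0.
congr (_ + _); last first.
  (* Output entropy: the mass of the final [mu] is the probability of the output word. *)
  rewrite -sumrN !big_snoc; apply: eq_bigr => ys _; apply: eq_bigr => y _ /=.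
  rewrite (mu_snoc y (cond_action_avg ys)) mass_ufilt//; last exact: Aset_avg.
  under [in RHS]eq_bigr do under eq_bigr do rewrite cond_action_avg.
  rewrite -(sum_lst1 (fun h : H t => nu h ys * q h.1 h.2 ys y)); congr (- xlnx _).
  rewrite -(pair_big xpredT xpredT (fun xs s1 =>
    \sum_(ss | tat ss 0 == s1) law Q PX1 PS1 q ss xs (snoc ys y)))/=.
  transitivity (\sum_xs \sum_ss nu (xs, ss) ys * q xs ss ys y).
    apply: eq_bigr => xs _; rewrite sum_init_charge.
    by apply: eq_bigr => ss _; rewrite law_nu.
  by rewrite pair_big/=; apply: eq_bigr => -[xs ss].
rewrite big_ord_recr/= sum_costs addrAC; congr (_ - _).
  rewrite -(pair_big xpredT xpredT (fun xs s1 => \sum_ys xlnx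
    (\sum_(ss | tat ss 0 == s1) law Q PX1 PS1 q ss xs ys)))/=.
  rewrite costE -big_split; apply: eq_bigr => xs _ /=.
  rewrite -big_split -sum_init_charge; apply: eq_bigr => s1 _ /=.
  (* Given the initial charge, demands and outputs, one charge path at most has positive weight, so
     [xlnx] passes under the sum. *)
  under eq_bigr => ys _.
    rewrite xlnx_sum_unique; last first.
      move=> ss ss' /eqP e /eqP e'; rewrite -[ys]snoc_pre !law_nu.
      rewrite !mulf_eq0 !negb_or => /andP[n1 _] /andP[n2 _].
      by apply: nu_unique n1 n2; rewrite e e'.
    over.
  rewrite exchange_big; apply: eq_bigr => ss _ /=.
  rewrite -big_split big_snoc; apply: eq_bigr => ys _ /=.
  by rewrite addrC -sum_xlnx_nu_q; apply: eq_bigr => y _; rewrite law_nu.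
(* Input marginal: summing out the last output turns the law into [pX]. *)
rewrite [RHS]pair_big/=; apply: eq_bigr => -[xs s1] _ /=; congr xlnx.
rewrite exchange_big; apply: eq_bigr => ss _ /=.
rewrite big_snoc; apply: eq_bigr => ys _ /=.
under eq_bigr do rewrite law_nu.
by rewrite -mulr_sumr q_sum1 mulr1.
Qed.

Lemma leak_ge t : uval my Q t.+1 (pi1 PX1 PS1) / t.+1%:R <= leak Q PX1 PS1 t.+1 q.
Proof.
rewrite leak_costs ler_pM2r ?invr_gt0 ?ltr0n//.
by have := uval_le_costs t.+1 0; rewrite addn0.
Qed.

End trajectories.

(** * The policy built from minimisers attains the bound *)

Section optimal_policy.
Variables (R : realType) (mx my ms : nat) (Q : 'M[R]_mx.+1).
Variables (PX1 : 'I_mx.+1 -> R) (PS1 : 'I_ms.+1 -> R).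
Local Notation X := 'I_mx.+1.
Local Notation Y := 'I_my.+1.
Local Notation S := 'I_ms.+1.
Local Notation M := 'M[R]_(mx.+1, ms.+1).
Variable phi0 : M -> Y -> (X -> S -> Y -> R) -> M.
Variable f : nat -> M -> (X -> S -> Y -> R).
Variable T : nat.

Hypothesis mxy : (mx <= my)%N.
Hypothesis stQ : stochastic Q.
Hypothesis pmfX : is_pmf PX1.
Hypothesis pmfS : is_pmf PS1.
Hypothesis phi0_simplex : forall pi y a, simplex (phi0 pi y a).
Hypothesis Af : forall t pi, Aset (f t pi).
Hypothesis fmin : forall t pi, (1 <= t <= T)%N -> simplex pi ->
  bell Q phi0 (f t pi) (Vt Q phi0 T t.+1) pi = Vt Q phi0 T t pi.

Local Notation qs := (qstar Q phi0 PX1 PS1 f).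
Local Notation bel := (bel Q phi0 PX1 PS1 f).
Local Notation nus := (nu Q PX1 PS1 qs).
Local Notation mus := (mu Q PX1 PS1 qs).

Lemma QA_qstar : QA qs.
Proof. by move=> t xs ss ys; exact: Af. Qed.

Lemma simplex_pi1 : simplex (pi1 PX1 PS1).
Proof.
split => [x s|]; first by rewrite mxE mulr_ge0//; [case: pmfX|case: pmfS].
under eq_bigr do under eq_bigr do rewrite mxE.
under eq_bigr do rewrite -mulr_sumr pmfS.2 mulr1.
exact: pmfX.2.
Qed.

(** [bel] reads an infinite sequence, obtained from a word by padding; this compares [ys] and
    [snoc ys y] on their common prefix. *)
Lemma bel_ext u v t : (forall j, (j < t)%N -> u j = v j) -> bel u t = bel v t.
Proof.
elim: t => // t IH uv /=; rewrite uv// IH// => j jt.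
by rewrite uv// ltnW.
Qed.

Lemma simplex_bel u t : simplex (bel u t).
Proof.
elim: t => [|t IH]; first exact: simplex_pi1.
by apply: filt_simplex => //; case: IH.
Qed.

Lemma cond_action_qstar t (ys : {ffun 'I_t -> Y}) :
  cond_action Q PX1 PS1 qs ys (f t.+1 (bel (tat ys) t)).
Proof.
move=> x s y; rewrite mxE mulr_suml; apply: eq_bigr => h.
by rewrite /lst => /eqP[<- <-].
Qed.

(** Stated without division, so that output words of probability zero are covered. *)
Lemma mu_bel t (ys : {ffun 'I_t -> Y}) :
  mus ys = mass (mus ys) *: bel (tat ys) t.
Proof.
elim: t ys => [|t IH] ys.
  rewrite mu0 /= (_ : mass _ = 1) ?scale1r//.
  by have [] := simplex_pi1.
rewrite -[ys]snoc_pre; move: (pre ys t) (ys ord_max) => {}ys y.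
have -> : bel (tat (snoc ys y)) t.+1 =
    filt Q phi0 (bel (tat ys) t) y (f t.+1 (bel (tat ys) t)).
  rewrite /= tat_snoc_max (@bel_ext _ (tat ys))// => j jt.
  by rewrite tat_snoc.
rewrite (mu_snoc y (cond_action_qstar ys)) IH ufiltZ massZ.
set a := f _ _; set b := bel _ _; have [cb _] := simplex_bel (tat ys) t.
by rewrite {1}(ufilt_filt phi0 stQ y (Af _ _) cb) scalerA.
Qed.

Lemma uval_step_qstar k t (ys : {ffun 'I_t -> Y}) : (t + k.+1)%N = T ->
  uval my Q k.+1 (mus ys) =
  \sum_h nus h ys * (\sum_y xlnx (qs h.1 h.2 ys y))
  + \sum_y uval my Q k (mus (snoc ys y)).
Proof.
move=> tk; set b := bel (tat ys) t; set a := f t.+1 b.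
have sb : simplex b := simplex_bel _ _; have [cb mb] := sb.
have Aa : Aset a := Af _ _.
have bmin : ucost Q (uval my Q k) a b = uval my Q k.+1 b.
  (* The 0-based time [t] is stage [t.+1] of [Vt], with [k.+1] stages left. *)
  have tT : (1 <= t.+1 <= T)%N by lia.
  have := fmin tT sb; rewrite -/a /Vt.
  have -> : (T.+1 - t.+2)%N = k by lia.
  have -> : (T.+1 - t.+1)%N = k.+1 by lia.
  rewrite [X in _ = X -> _]Vrem_uval// => <-.
  by apply/esym/bell_ucost => // p; exact: Vrem_uval.
have m0 : 0 <= mass (mus ys).
  by apply: mass_ge0; apply: cone_mu => //; exact: QA_qstar.
transitivity (ucost Q (uval my Q k) a (mus ys)).
  rewrite mu_bel -/b uvalZ// ucostZ ?bmin// => p cp.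
  exact: uvalZ.
rewrite /ucost; congr (_ + _); last first.
  by apply: eq_bigr => y _; rewrite (mu_snoc y (cond_action_qstar ys)).
under eq_bigr do under eq_bigr do rewrite mxE.
by rewrite -(sum_lst (fun h => nus h ys) (fun x s => \sum_y xlnx (a x s y))).
Qed.

Lemma uval_costs_qstar t k : (t + k)%N = T ->
  uval my Q T (pi1 PX1 PS1) =
  \sum_(j < t) cost Q PX1 PS1 qs j
  + \sum_(ys : {ffun 'I_t -> Y}) uval my Q k (mus ys).
Proof.
elim: t k => [|t IH] k tk.
  rewrite big_ord0 add0r (big_ffun0 _ [ffun=> ord0]) mu0.
  by rewrite -tk.
rewrite (IH k.+1) ?addnS// big_ord_recr/= -addrA; congr (_ + _).
rewrite big_snoc /cost -big_split; apply: eq_bigr => ys _.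
by apply: uval_step_qstar; rewrite addnS.
Qed.

Lemma leak_qstar : (0 < T)%N ->
  leak Q PX1 PS1 T qs = Vrem Q phi0 T (pi1 PX1 PS1) / T%:R.
Proof.
move=> T0; rewrite Vrem_uval//; last exact: simplex_pi1.
case: T T0 uval_costs_qstar => // t _ /(_ t.+1 0) ->; rewrite ?addn0//.
apply: leak_costs => //; exact: QA_qstar.
Qed.

End optimal_policy.

Theorem theorem1 (R : realType) (mx my ms : nat)
  (Q : 'M[R]_(mx.+1)) (PX1 : 'I_mx.+1 -> R) (PS1 : 'I_ms.+1 -> R)
  (phi0 : 'M[R]_(mx.+1, ms.+1) -> 'I_my.+1 ->
          ('I_mx.+1 -> 'I_ms.+1 -> 'I_my.+1 -> R) -> 'M[R]_(mx.+1, ms.+1))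
  (T : nat) :
  (mx <= my)%N ->
  stochastic Q -> irreducible Q -> aperiodic Q ->
  is_pmf PX1 -> is_pmf PS1 ->
  (forall pi y a, simplex (phi0 pi y a)) ->
  (0 < T)%N ->
  [/\ (* (1) continuity and concavity of V_t *)
      (forall t, (1 <= t <= T.+1)%N ->
         {within simplex, continuous (Vt Q phi0 T t)} /\
         concave_on simplex (Vt Q phi0 T t)),
      (* (1) the minimum defining V_t is attained *)
      (forall t, (1 <= t <= T)%N -> forall pi, simplex pi ->
         (exists a, Aset a /\ bell Q phi0 a (Vt Q phi0 T t.+1) pi = Vt Q phi0 T t pi) /\
         (forall a, Aset a -> Vt Q phi0 T t pi <= bell Q phi0 a (Vt Q phi0 T t.+1) pi)),
      (* (2) the policy induced by any minimizer selector is optimal *)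
      (forall f : nat -> 'M[R]_(mx.+1, ms.+1) ->
                  ('I_mx.+1 -> 'I_ms.+1 -> 'I_my.+1 -> R),
         (forall t pi, Aset (f t pi)) ->
         (forall t pi, (1 <= t <= T)%N -> simplex pi ->
            bell Q phi0 (f t pi) (Vt Q phi0 T t.+1) pi = Vt Q phi0 T t pi) ->
         QA (qstar Q phi0 PX1 PS1 f) /\
         (forall q : policy R mx my ms, QA q -> leak Q PX1 PS1 T (qstar Q phi0 PX1 PS1 f) <= leak Q PX1 PS1 T q))
    & (* (3) optimal leakage = V_1(pi_1) / T *)
      (exists q : policy R mx my ms, QA q /\ leak Q PX1 PS1 T q = Vt Q phi0 T 1 (pi1 PX1 PS1) / T%:R) /\
      (forall q : policy R mx my ms, QA q -> Vt Q phi0 T 1 (pi1 PX1 PS1) / T%:R <= leak Q PX1 PS1 T q)].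
Proof.
move=> mxy stQ _ _ pmfX pmfS phi0_simplex T0.
have attained t pi : (1 <= t <= T)%N -> simplex pi ->
    exists a, Aset a /\ bell Q phi0 a (Vt Q phi0 T t.+1) pi = Vt Q phi0 T t pi.
  move=> /andP[t0 tT] spi; rewrite /Vt subSS subSn//; exact: bell_attained.
have lower (q : policy R mx my ms) : QA q ->
     Vrem Q phi0 T (pi1 PX1 PS1) / T%:R <= leak Q PX1 PS1 T q.
  move=> Qq; rewrite Vrem_uval//; last exact: simplex_pi1.
  by case: T T0 {attained} => // t _; exact: leak_ge.
split.
- by move=> t _; split; [exact: continuous_Vrem|exact: concave_Vrem].
- move=> t tT pi spi; split; first exact: attained.
  move=> a Aa; have /andP[t0 tT'] := tT.
  by rewrite /Vt subSS subSn//; exact: Vrem_le.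
- move=> f Af fmin; split; first exact: QA_qstar.
  by move=> q Qq; rewrite leak_qstar//; exact: lower.
- rewrite /Vt subSS subn0; split => //.
  (* A selector must be admissible for every stage and matrix; [direct] fills in where no minimiser
     is asked for. *)
  have sel (p : nat * 'M[R]_(mx.+1, ms.+1)) : exists a, Aset a /\
      ((1 <= p.1 <= T)%N -> simplex p.2 ->
       bell Q phi0 a (Vt Q phi0 T p.1.+1) p.2 = Vt Q phi0 T p.1 p.2).
    have [[tT spi]|h] := pselect ((1 <= p.1 <= T)%N /\ simplex p.2).
      by have [a [Aa E]] := attained _ _ tT spi; exists a.
    exists (direct R mxy); split; first exact: Aset_direct.
    by move=> tT spi; case: h.
  have [g gP] := choice sel.
  exists (qstar Q phi0 PX1 PS1 (fun t pi => g (t, pi))); split.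
    by apply: QA_qstar => t pi; have [] := gP (t, pi).
  apply: leak_qstar => // t pi; first by have [] := gP (t, pi).
  by have [_] := gP (t, pi).
Qed.
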